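(* Let $G$ be a countably infinite locally finite abelian group (written additively), and let $G_\bullet=(G_i)_{i\ge1}$ be any filtration of $G$ by finite subgroups. If $A\subseteq G$ satisfies $\overline d_{G_\bullet}(\mathcal P(A))>0$, then there exists an infinite set $B\subseteq\mathcal P(A)$ such that $$B+B\subseteq\mathcal P(A).$$
   Context: An abelian group is locally finite if every finitely generated subgroup is finite. A filtration of $G$ by finite subgroups is a chain $G_1\le G_2\le\cdots$ of finite subgroups with $\bigcup_{i\ge1}G_i=G$. For $A\subseteq G$, $\mathcal P(A):=\{\sum_{a\in F}a : F\subseteq A,\ |F|<\infty\}$ is the set of finite subset sums, including the empty sum $0$. For $S\subseteq G$, $\overline d_{G_\bullet}(S):=\limsup_{i\to\infty}|S\cap G_i|/|G_i|$. For $B\subseteq G$, $B+B:=\{b+b':b,b'\in B\}$ (with $b=b'$ allowed). *)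

(* Defs.v *)
From mathcomp Require Import all_boot all_order all_algebra finmap.
From mathcomp Require Import all_classical reals ereal topology normedtype.
From mathcomp Require Import sequences.

Set Implicit Arguments.
Unset Strict Implicit.
Unset Printing Implicit Defensive.

Import Order.TTheory GRing.Theory Num.Theory.

Local Open Scope classical_set_scope.
Local Open Scope ring_scope.

Section Definitions.
Variable G : zmodType.
Implicit Types (S A B H : set G) (Gs : nat -> set G).

Definition subgroup H : Prop := zmod_closed (mem H).

Definition generated S : set G := smallest subgroup S.

Definition locally_finite : Prop :=
  forall S, finite_set S -> finite_set (generated S).

(* Indices start at 0, so [Gs i] plays the role of G_(i+1). *)
Definition filtration Gs : Prop :=
  [/\ forall i, subgroup (Gs i),
      forall i, finite_set (Gs i),
      forall i, Gs i `<=` Gs i.+1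
    & \bigcup_i Gs i = [set: G]].

Definition subset_sums A : set G :=
  [set \sum_(a <- F) a | F in [set F : {fset G} | [set` F] `<=` A]].

Definition sumset A B : set G := [set a + b | a in A & b in B].

(* [fset_set X] is empty when [X] is infinite; only finite sets [Gs i] are
   meant here. *)
Definition upper_density (R : realType) Gs S : \bar R :=
  limn_esup (fun i : nat =>
    (#|` fset_set (S `&` Gs i)|%:R / #|` fset_set (Gs i)|%:R)%:E).

End Definitions.

Arguments locally_finite G : clear implicits.

(* Main.v *)
(* Write P(A) for the subset sums. It suffices that for every finite E the set
   V(E) of b with b and 2b in P(A \ E) is infinite: then sums b_n over pairwise
   disjoint sets, with 2b_n in P(A), can be picked greedily.
   If some V(E) is finite, one of minimal size is a finite subgroup K with
   V(E') = K for all E' containing E. After deleting E and K from A, every b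
   with b and 2b in P(A) lies in K. Call a finite subset of A null if its sum is
   in K. Null sets are closed under intersection, so each a in A has a companion
   p(a) <> a lying in every null set that contains a. Choose e_0, e_1, ... in A
   with e_n different from all e_i and p(e_i), i < n. The sets
     T_j = e_j - (e_0 + ... + e_(j-1)) + P(A \ {e_j, p(e_j)})
   have at least a quarter of the density of P(A). If T_j and T_l meet, j < l,
   the coincidence is a relation with coefficients in {-1, 0, 1, 2}, that is
   2 sum X = sum Y, with e_j in X and p(e_j) not in X; but then X is null. So the
   T_j are pairwise disjoint and P(A) has density zero. *)
Require Import Defs.
From mathcomp Require Import all_boot all_order all_algebra finmap.
From mathcomp Require Import all_classical reals ereal topology normedtype.
From mathcomp Require Import sequences.

Set Implicit Arguments.
Unset Strict Implicit.
Unset Printing Implicit Defensive.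

Import Order.TTheory GRing.Theory Num.Theory.
Local Open Scope classical_set_scope.
Local Open Scope ring_scope.

(** * Algebra of finite subset sums *)

Section SubsetSums.
Variable G : zmodType.
Implicit Types (A B S : set G) (E F J : {fset G}) (a b x y : G).

Lemma subset_sumsI A F : [set` F] `<=` A -> subset_sums A (\sum_(a <- F) a).
Proof. by exists F. Qed.

Lemma subset_sums0 A : subset_sums A 0.
Proof. by exists fset0; rewrite ?big_seq_fset0//= => x /=; rewrite inE. Qed.

Lemma subset_sumsS A B : A `<=` B -> subset_sums A `<=` subset_sums B.
Proof. by move=> AB _ [F FA <-]; exists F => //; apply: subset_trans FA AB. Qed.

Lemma sum_fsetE F E : (F `<=` E)%fset ->
  \sum_(a <- F) a = \sum_(a <- E) a *+ (a \in F).
Proof.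
move=> FE; rewrite -(big_fset_incl _ FE) => [|a _ /negPf-> //].
by rewrite big_seq [RHS]big_seq; apply: eq_bigr => a ->.
Qed.

Lemma sum_fsetU E F : [disjoint E & F]%fset ->
  \sum_(a <- (E `|` F)%fset) a = \sum_(a <- E) a + \sum_(a <- F) a.
Proof.
move=> EF; rewrite (sum_fsetE (fsubsetUl E F)) (sum_fsetE (fsubsetUr E F)).
rewrite (sum_fsetE (fsubset_refl _)) -big_split/=; apply: eq_bigr => a _.
rewrite -mulrnDr !inE; case aE: (a \in E); case aF: (a \in F) => //=.
by have /fdisjointP/(_ a aE) := EF; rewrite aF.
Qed.

Lemma subset_sumsD A E F : [set` E] `<=` A -> [set` F] `<=` A ->
  [disjoint E & F]%fset ->
  subset_sums A (\sum_(a <- E) a + \sum_(a <- F) a).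
Proof.
move=> EA FA EF; rewrite -sum_fsetU//; apply: subset_sumsI => x /=.
by rewrite inE => /orP[/EA|/FA].
Qed.

Lemma subset_sums_addD A E y : [set` E] `<=` A ->
  subset_sums (A `\` [set` E]) y -> subset_sums A (\sum_(a <- E) a + y).
Proof.
move=> EA [F FA <-]; apply: subset_sumsD => //; first by move=> x /FA[].
by apply/fdisjointP => x xE; apply/negP => /FA[_]; apply.
Qed.

Lemma subset_sumsD1 A a x : subset_sums A x ->
  subset_sums (A `\` [set a]) x \/ subset_sums (A `\` [set a]) (x - a).
Proof.
move=> [F FA <-]; have [aF|aF] := boolP (a \in F).
  right; rewrite (big_fsetD1 a)//= addrAC subrr add0r; apply: subset_sumsI => b /=.
  by rewrite !inE => /andP[/eqP ba /FA bA]; split.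
left; apply: subset_sumsI => b /= bF; split; first exact: FA.
by move=> /= ba; rewrite ba (negPf aF) in bF.
Qed.

(* The pattern [1_B + 1_E - 1_F] takes values in [{-1, 0, 1, 2}], so it is
   [2 1_X - 1_Y] with [X] its positive part and [Y] its odd part. *)
Lemma sum_relation_double A (B E F : {fset G}) : [set` B] `<=` A ->
    [set` E] `<=` A -> [set` F] `<=` A ->
    \sum_(a <- B) a + \sum_(a <- E) a = \sum_(a <- F) a ->
  let X := ((B `&` E) `|` ((B `|` E) `\` F))%fset in
  [/\ [set` X] `<=` A & subset_sums A ((\sum_(a <- X) a) *+ 2)].
Proof.
move=> BA EA FA eBEF X; set U := (B `|` E `|` F)%fset.
have UA : [set` U] `<=` A.
  by move=> x /=; rewrite !inE => /orP[/orP[/BA|/EA]|/FA].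
have BU : (B `<=` U)%fset by apply/fsubsetP => x; rewrite !inE => ->.
have EU : (E `<=` U)%fset by apply/fsubsetP => x; rewrite !inE => ->; rewrite orbT.
have FU : (F `<=` U)%fset by apply/fsubsetP => x; rewrite !inE => ->; rewrite !orbT.
have XU : (X `<=` U)%fset.
  apply/fsubsetP => x; rewrite !inE.
  by case: (x \in B); case: (x \in E); case: (x \in F).
split; first by move=> x /(fsubsetP XU)/UA.
pose Y := [fset x in U | (x \in B) (+) (x \in E) (+) (x \in F)]%fset.
have YU : (Y `<=` U)%fset by apply/fsubsetP => x; rewrite !inE => /andP[].
suff -> : (\sum_(a <- X) a) *+ 2 = \sum_(a <- Y) a.
  by apply: subset_sumsI => x /(fsubsetP YU)/UA.
(* Adding [F] on the left and [B + E] on the right leaves an identity between natural coefficients,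
   checked element by element. *)
apply: (addIr (\sum_(a <- F) a)); rewrite -{2}eBEF.
rewrite (sum_fsetE BU) (sum_fsetE EU) (sum_fsetE FU) (sum_fsetE XU) (sum_fsetE YU).
rewrite -sumrMnl -!big_split/= big_seq [RHS]big_seq; apply: eq_bigr => a aU.
rewrite -mulrnA -!mulrnDr /Y !inE/=; congr (_ *+ _).
by move: aU; rewrite /U !inE;
  case: (a \in B); case: (a \in E); case: (a \in F).
Qed.

End SubsetSums.

(** * Counting along the filtration, and positive upper density *)

Section Counting.
Variables (G : zmodType) (Gs : nat -> set G).
Hypothesis Gs_filtration : filtration Gs.
Implicit Types (A S T : set G) (E : {fset G}) (g : G) (i k n : nat).

Definition trace_card S i : nat := #|` fset_set (S `&` Gs i)|.

(* Upper density at least [1 / k], cleared of denominators. *)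
Definition frequently_dense k S : Prop :=
  forall n, exists2 i, (n <= i)%N & (trace_card setT i <= k * trace_card S i)%N.

Lemma filtration0 i : Gs i 0.
Proof.
by have [/(_ i)[/set_mem ? _] _ _ _] := Gs_filtration.
Qed.

Lemma filtrationB i g h : Gs i g -> Gs i h -> Gs i (g - h).
Proof.
move=> Gg Gh; have [/(_ i)[_ GB] _ _ _] := Gs_filtration.
by apply: set_mem; apply: GB; exact: mem_set.
Qed.

Lemma filtrationD i g h : Gs i g -> Gs i h -> Gs i (g + h).
Proof.
move=> Gg Gh; rewrite -[h]opprK; apply: filtrationB => //.
by rewrite -sub0r; apply: filtrationB => //; exact: filtration0.
Qed.

Lemma filtrationS i j : (i <= j)%N -> Gs i `<=` Gs j.
Proof.
have [_ _ GsS _] := Gs_filtration.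
elim: j => [|j IH]; first by rewrite leqn0 => /eqP->.
by rewrite leq_eqVlt => /predU1P[->//|/IH /subset_trans]; apply.
Qed.

Lemma filtration_fset E : exists i, [set` E] `<=` Gs i.
Proof.
have [_ _ _ GsT] := Gs_filtration.
elim/fset1U_rect: E => [|g E _ [i EGi]]; first by exists 0%N => x /=; rewrite inE.
have [j _ Gjg] : (\bigcup_i Gs i) g by rewrite GsT.
exists (maxn i j) => x /=; rewrite !inE => /predU1P[->|/EGi].
  exact: filtrationS (leq_maxr i j) _ Gjg.
exact: filtrationS (leq_maxl i j) _.
Qed.

Lemma finite_trace S i : finite_set (S `&` Gs i).
Proof.
have [_ + _ _] := Gs_filtration => /(_ i).
by apply: sub_finite_set; exact: subIsetr.
Qed.

Lemma trace_card_le S T i : S `&` Gs i `<=` T -> (trace_card S i <= trace_card T i)%N.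
Proof.
move=> ST; apply: fsubset_leq_card; rewrite -fset_set_sub; try exact: finite_trace.
by move=> x SGx; split; [exact: ST | case: SGx].
Qed.

Lemma trace_card_setT_gt0 i : (0 < trace_card setT i)%N.
Proof.
rewrite cardfs_gt0; apply/fset0Pn; exists 0.
by rewrite in_fset_set ?inE; [split => //; exact: filtration0|exact: finite_trace].
Qed.

Lemma trace_cardU S T i :
  (trace_card (S `|` T) i <= trace_card S i + trace_card T i)%N.
Proof.
rewrite /trace_card setIUl fset_setU; try exact: finite_trace.
by rewrite -cardfsUI leq_addr.
Qed.

(** Translation by [g] is injective and preserves [Gs i]; using it for [g] and for [- g] gives the
    two inequalities. *)
Lemma trace_card_shift S g i : Gs i g ->
  trace_card [set x | S (x - g)] i = trace_card S i.
Proof.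
suff shift_le T h : Gs i h -> (trace_card T i <= trace_card [set x | T (x - h)%R] i)%N.
  move=> Gg; apply/eqP; rewrite eqn_leq (shift_le S g)// andbT.
  have GNg : Gs i (- g).
    by rewrite -sub0r; apply: filtrationB => //; exact: filtration0.
  apply: leq_trans (shift_le _ _ GNg) _; apply: trace_card_le => x [/=].
  by rewrite opprK addrK.
move=> Gh; rewrite /trace_card.
rewrite -[X in (X <= _)%N](card_imfset imfset_key (mem (fset_set _)) (addIr h)).
apply/fsubset_leq_card/fsubsetP => _ /imfsetP[x /= + ->].
rewrite !in_fset_set ?inE; try exact: finite_trace.
by move=> [Tx Gx]; split; [rewrite /= addrK | exact: filtrationD].
Qed.

Lemma sum_trace_card_le (T : nat -> set G) i n :
    (forall j l, (j < l)%N -> T j `&` T l = set0) ->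
  (\sum_(j < n) trace_card (T j) i <= trace_card setT i)%N.
Proof.
move=> T_disj.
suff : (\sum_(j < n) trace_card (T j) i <=
        trace_card [set x | exists2 j, (j < n)%N & T j x] i)%N.
  by move/leq_trans; apply; apply: trace_card_le.
elim: n => [|n IH]; first by rewrite big_ord0.
rewrite big_ord_recr/=; set U := [set x | exists2 j, (j < n)%N & T j x] in IH.
apply: (@leq_trans (trace_card U i + trace_card (T n) i)); first by rewrite leq_add2r.
rewrite {1 2}/trace_card -cardfsUI -fset_setI; try exact: finite_trace.
rewrite (_ : _ `&` _ `&` _ = set0) ?fset_set0 ?cardfs0 ?addn0; last first.
  rewrite -subset0 => x [[[j jn Tjx] _] [Tnx _]].
  by rewrite -(T_disj j n jn).
rewrite -fset_setU; try exact: finite_trace.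
rewrite -setIUl; apply: trace_card_le => x [[[j jn Tjx]|Tnx] _].
  by exists j => //; rewrite ltnW.
by exists n.
Qed.

(** The sums over [A] are covered by the sums avoiding [g] and their translate by [g], which have
    equal counts in [Gs i]. *)
Lemma trace_card_subset_sumsD1 A g i : Gs i g ->
  (trace_card (subset_sums A) i <= 2 * trace_card (subset_sums (A `\` [set g])) i)%N.
Proof.
move=> Gg; set S := subset_sums _; rewrite mul2n -addnn.
rewrite -{2}(trace_card_shift (subset_sums (A `\` [set g])) Gg).
apply: leq_trans (trace_cardU _ _ _); apply: trace_card_le => x [Sx _].
by have [] := subset_sumsD1 g Sx; [left|right].
Qed.

(** Each deleted element doubles the constant, once the index is large enough for [Gs i] to contain
    it. *)
Lemma frequently_dense_subset_sumsD A k E :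
  frequently_dense k (subset_sums A) ->
  exists k', frequently_dense k' (subset_sums (A `\` [set` E])).
Proof.
move=> dA; elim/fset1U_rect: E => [|g E _ [k' dE]].
  by exists k; rewrite (_ : [set` fset0] = set0) ?setD0//; apply/seteqP; split => x.
have [i0 gi0] : exists i, Gs i g.
  by have [i Gi] := filtration_fset [fset g]%fset; exists i; apply: Gi; exact: fset11.
exists (k' * 2)%N => n; have [i ni di] := dE (maxn n i0).
exists i; first exact: leq_trans (leq_maxl n i0) ni.
apply: (leq_trans di); rewrite -mulnA leq_mul2l; apply/orP; right.
rewrite (_ : A `\` [set` (g |` E)%fset] = (A `\` [set` E]) `\` [set g]); last first.
  rewrite setDDl; congr (_ `\` _); apply/seteqP; split => x /=; rewrite !inE.
    by case/predU1P; [right|left].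
  by case=> [->|->]; rewrite ?orbT ?eqxx.
apply: trace_card_subset_sumsD1; apply: filtrationS gi0.
exact: leq_trans (leq_maxr n i0) ni.
Qed.

(** If [A] were inside [E], then [0] would be the only sum avoiding [E], and [{0}] has density zero
    because the [Gs i] grow without bound. *)
Lemma frequently_dense_escape A k E : infinite_set [set: G] ->
  frequently_dense k (subset_sums A) -> exists2 a, A a & a \notin E.
Proof.
move=> Ginf /(frequently_dense_subset_sumsD E)[k' dAE]; apply: contrapT => AE.
have AE0 : A `\` [set` E] = set0.
  rewrite -subset0 => a [Aa /= /negP aE]; apply: AE; exists a => //.
have [F _ Fk'] := infinite_set_fset k'.+1 Ginf.
have [j Fj] := filtration_fset F; have [i ji /=] := dAE j.
apply/negP; rewrite -ltnNge AE0; apply: (@leq_trans #|` F|); last first.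
  apply/fsubset_leq_card/fsubsetP => x xF.
  rewrite in_fset_set ?inE; last exact: finite_trace.
  by split=> //; apply: filtrationS ji _ _; exact: Fj.
apply: leq_trans Fk'; rewrite ltnS -{2}[k']muln1 leq_mul2l; apply/orP; right.
rewrite -(cardfs1 (0 : G)); apply/fsubset_leq_card/fsubsetP => x.
rewrite in_fset_set ?inE; last exact: finite_trace.
case=> -[H H0 <-] _; rewrite (_ : H = fset0) ?big_seq_fset0//.
by apply/fsetP => y; rewrite inE; apply/negP => /H0.
Qed.

Lemma frequently_dense_upper_density (R : realType) S :
  (0 < upper_density R Gs S)%E -> exists k, frequently_dense k S.
Proof.
apply: contraPP => /forallNP nd; apply/negP; rewrite -leNgt.
apply/lee_addgt0Pr => e e0; rewrite add0e.
(* As 1/k < e, failing to be frequently dense for [k] keeps all late ratios below [e]. *)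
pose k := (Num.bound e^-1).
have /existsNP[n /forall2NP ndk] := nd k.
rewrite /upper_density limn_esup_lim.
apply: lime_le; first exact: is_cvg_esups.
exists n => // m /= nm; apply: ub_ereal_sup => _ [i /= mi <-].
have [/negP|/negP] := ndk i; first by rewrite (leq_trans nm mi).
rewrite -ltnNge /trace_card setTI => ki.
rewrite lee_fin ler_pdivrMr; last by rewrite ltr0n (leq_ltn_trans _ ki).
have e'k : e^-1 < k%:R by rewrite archi_boundP// ltW// invr_gt0.
rewrite -ler_pdivrMl//; apply: le_trans (_ : k%:R * #|` fset_set (S `&` Gs i)|%:R <= _).
  by rewrite ler_wpM2r// ltW.
by rewrite -natrM ler_nat ltnW.
Qed.

End Counting.

(** The list holds all earlier terms, so each choice may depend on the whole history; both greedy
    constructions below use this. *)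
Lemma seq_dependent_choice (T : Type) (P : seq T -> T -> Prop) :
    (forall s, exists x, P s x) ->
  exists f : nat -> T, forall n, P [seq f i | i <- iota 0 n] (f n).
Proof.
move=> /choice[g Pg].
pose s := fix s n := if n is m.+1 then rcons (s m) (g (s m)) else [::].
exists (g \o s) => n; suff -> : [seq (g \o s) i | i <- iota 0 n] = s n by apply: Pg.
by elim: n => [//|n IH]; rewrite -[in LHS]addn1 iotaD map_cat IH cats1.
Qed.

(** * Density zero when doubling is confined to a finite subgroup *)

Section DoublingObstruction.
Variables (G : zmodType) (A : set G) (K : set G).
Hypothesis K0 : K 0.
Hypothesis KB : forall x y, K x -> K y -> K (x - y).
Hypothesis K_subset_sums : forall E : {fset G}, K `<=` subset_sums (A `\` [set` E]).
Hypothesis double_subset_sums :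
  forall b, subset_sums A b -> subset_sums A (b *+ 2) -> K b.
Hypothesis AK : A `&` K = set0.

(* With [D = E \ F] and [N = F \ E], [2 sum D = sum D + sum N + k] for some
   [k] in [K], and [k] is a subset sum avoiding [D] and [N]. *)
Lemma sum_fsetI_in (E F : {fset G}) : [set` E] `<=` A -> [set` F] `<=` A ->
    K (\sum_(a <- E) a) -> K (\sum_(a <- F) a) ->
  K (\sum_(a <- (E `&` F)%fset) a).
Proof.
move=> EA FA KE KF.
have sumE : \sum_(a <- E) a =
    \sum_(a <- (E `&` F)%fset) a + \sum_(a <- (E `\` F)%fset) a.
  rewrite -sum_fsetU ?fsetID//; apply/fdisjointP => x; rewrite !inE.
  by case/andP=> _ ->.
have sumF : \sum_(a <- F) a =
    \sum_(a <- (E `&` F)%fset) a + \sum_(a <- (F `\` E)%fset) a.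
  rewrite fsetIC -sum_fsetU ?fsetID//; apply/fdisjointP => x; rewrite !inE.
  by case/andP=> _ ->.
have DA : [set` (E `\` F)%fset] `<=` A by move=> x /=; rewrite !inE => /andP[_ /EA].
have NA : [set` (F `\` E)%fset] `<=` A by move=> x /=; rewrite !inE => /andP[_ /FA].
have DN : [disjoint E `\` F & F `\` E]%fset.
  by apply/fdisjointP => x; rewrite !inE => /andP[/negPf-> _]; rewrite andbF.
suff KDs : K (\sum_(a <- (E `\` F)%fset) a).
  rewrite (_ : \sum_(a <- _) a = \sum_(a <- E) a - \sum_(a <- (E `\` F)%fset) a).
    exact: KB.
  by rewrite sumE addrK.
apply: double_subset_sums; first exact: subset_sumsI.
have -> : (\sum_(a <- (E `\` F)%fset) a) *+ 2 =
    \sum_(a <- ((E `\` F) `|` (F `\` E))%fset) a +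
    (\sum_(a <- E) a - \sum_(a <- F) a).
  rewrite sum_fsetU// sumE sumF mulr2n.
  rewrite [\sum_(a <- (E `&` F)%fset) a + \sum_(a <- (E `\` F)%fset) a]addrC.
  by rewrite addrKA addrACA subrr addr0.
apply: subset_sums_addD; last by apply: K_subset_sums; exact: KB.
by move=> x /=; rewrite in_fsetU => /orP[/DA|/NA].
Qed.

(** Take a null set through [a] of least size. It is not [{a}], since [a] is outside [K]; by
    minimality its intersection with any other null set through [a] is all of it, so any second
    element serves. *)
Lemma exists_companion a : A a -> exists2 b, b != a &
  forall E : {fset G}, [set` E] `<=` A -> K (\sum_(x <- E) x) -> a \in E -> b \in E.
Proof.
move=> Aa; pose null (E : {fset G}) := [/\ [set` E] `<=` A, K (\sum_(x <- E) x) & a \in E].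
have K'a : ~ K a by move=> Ka; have : (A `&` K) a by []; rewrite AK.
have [[E0 nullE0]|no_null] := pselect (exists E, null E); last first.
  (* The second condition is vacuous here, and [0] differs from [a] because [K] contains [0] but not
     [a]. *)
  exists 0 => [|E EA KE aE]; last by case: no_null; exists E.
  by apply/eqP => a0; apply: K'a; rewrite -a0.
have exn : exists n, `[< exists2 E, null E & #|` E| = n >].
  by exists #|` E0|; apply/asboolP; exists E0.
case: (ex_minnP exn) => _ /asboolP[E [EA KE aE] <-] E_min.
have [b /=] : exists b, b \in (E `\ a)%fset.
  apply/fset0Pn; apply/eqP => Ea0; apply: K'a.
  by move: KE; rewrite (big_fsetD1 a)//= Ea0 big_seq_fset0 addr0.
rewrite !inE => /andP[ba bE]; exists b => // F FA KF aF.
have nullEF : null (E `&` F)%fset.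
  split; [|exact: sum_fsetI_in|by rewrite inE aE].
  by move=> x /=; rewrite inE => /andP[/EA].
have /E_min EEF : `[< exists2 J, null J & #|` J| = #|` (E `&` F)%fset| >].
  by apply/asboolP; exists (E `&` F)%fset.
have /eqP EFE : (E `&` F)%fset == E by rewrite eqEfcard fsubsetIl.
by move: bE; rewrite -EFE inE => /andP[].
Qed.

Variable Gs : nat -> set G.
Hypothesis Gs_filtration : filtration Gs.
Hypothesis G_infinite : infinite_set [set: G].

Lemma doubling_obstruction_sparse k : ~ frequently_dense Gs k (subset_sums A).
Proof.
move=> dA.
have /choice[p pP] : forall a, exists b, A a -> b != a /\
    forall E : {fset G}, [set` E] `<=` A -> K (\sum_(x <- E) x) -> a \in E -> b \in E.
  move=> a; have [Aa|] := pselect (A a); last by exists a.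
  by have [b] := exists_companion Aa; exists b.
have [e eP] : exists e : nat -> G, forall n, A (e n) /\
    (e n \notin [seq e i | i <- iota 0 n] /\
     e n \notin [seq p (e i) | i <- iota 0 n]).
  have [s|e eP] := @seq_dependent_choice G (fun s a =>
      A a /\ (a \notin s /\ a \notin [seq p b | b <- s])).
    have [a Aa] := frequently_dense_escape Gs_filtration
      ([fset b in s] `|` [fset p b | b in s])%fset G_infinite dA.
    rewrite !inE/= negb_or => /andP[as_ aps]; exists a; split => //; split => //.
    apply: contra aps => /mapP[b bs ->]; exact: in_imfset.
  by exists e => n; have := eP n; rewrite -map_comp.
have eA n : A (e n) by have [] := eP n.
have e_neq i j : (i < j)%N -> e j != e i /\ e j != p (e i).
  have [_ [/negP ej /negP pej]] := eP j => ij.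
  have iij : i \in iota 0 j by rewrite mem_iota.
  split; apply/eqP => eji; [apply: ej|apply: pej]; rewrite eji.
    exact: (map_f e).
  exact: (map_f (p \o e)).
have e_inj : injective e.
  move=> i j eij; have [ij|ji|//] := ltngtP i j.
    by have [] := e_neq _ _ ij; rewrite eij eqxx.
  by have [] := e_neq _ _ ji; rewrite eij eqxx.
pose A' j := A `\` [set e j] `\` [set p (e j)].
(* For j < l, [t j - t l] is [e j + (e j + ... + e (l - 1)) - e l], in which [e j] counts twice. *)
pose t j := e j - \sum_(i <- iota 0 j) e i.
pose T j := [set x | subset_sums (A' j) (x - t j)].
have T_disj j l : (j < l)%N -> T j `&` T l = set0.
  move=> jl; rewrite -subset0 => x [[S SA xS] [S' SA' xS']].
  pose B := [fset e i | i in iota j (l - j)]%fset.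
  have sumB : \sum_(a <- B) a = \sum_(i <- iota j (l - j)) e i.
    by rewrite big_imfset//= ?undup_id ?iota_uniq// => i i' _ _; exact: e_inj.
  have BA : [set` B] `<=` A by move=> _ /imfsetP[i _ ->]; exact: eA.
  have SsA : [set` S] `<=` A by move=> y /SA[[]].
  have S'sA : [set` S'] `<=` A by move=> y /SA'[[]].
  have ejS : e j \notin S by apply/negP => /SA[[_ []]].
  have elS' : e l \notin S' by apply/negP => /SA'[[_ []]].
  have pjS : p (e j) \notin S by apply/negP => /SA[_ []].
  have pjB : p (e j) \notin B.
    apply/negP => /imfsetP[i]; rewrite /= mem_iota => /andP[ji _] peji.
    move: ji; rewrite leq_eqVlt => /predU1P[ji|/e_neq[_]]; last by rewrite peji eqxx.
    by have [/eqP] := pP _ (eA j); rewrite peji ji.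
  have ejB : e j \in B by apply: in_imfset; rewrite /= mem_iota leqnn subnKC// ltnW.
  have rel : \sum_(a <- B) a + \sum_(a <- (e j |` S)%fset) a =
      \sum_(a <- (e l |` S')%fset) a.
    rewrite !big_fsetU1//= xS xS' sumB /t.
    have -> : \sum_(i <- iota 0 l) e i =
        \sum_(i <- iota 0 j) e i + \sum_(i <- iota j (l - j)) e i.
      by rewrite -big_cat -[X in iota X (l - j)]add0n -iotaD subnKC// ltnW.
    have cancel u y : u + (x - (u - y)) = x + y by rewrite opprB addrC -addrA subrK.
    by rewrite !cancel addrC -addrA.
  have eSA : [set` (e j |` S)%fset] `<=` A.
    by move=> y /=; rewrite !inE => /predU1P[->//|/SsA].
  have eS'A : [set` (e l |` S')%fset] `<=` A.
    by move=> y /=; rewrite !inE => /predU1P[->//|/S'sA].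
  have := sum_relation_double BA eSA eS'A rel.
  set X := (_ `|` _)%fset => -[XA SX2].
  have KX := double_subset_sums (subset_sumsI XA) SX2.
  (* [e j] lies in both sets on the left of [rel], hence in [X], while its companion lies in
     neither. *)
  have ejX : e j \in X by rewrite !inE ejB eqxx.
  have [pj_neq /(_ X XA KX ejX)] := pP _ (eA j).
  by rewrite !inE (negPf pjB) (negPf pjS) (negPf pj_neq) /= andbF.
(* Two deletions cost a factor 4, so more than [4 * k] disjoint sets [T j] would overfill some
   [Gs i]. *)
have [N N_gt] : exists N, (4 * k < N)%N by exists (4 * k).+1.
(* From [i0] on, [Gs i] contains every deleted element and every shift [t j] with j < N. *)
have [i0 ei0] := filtration_fset Gs_filtration
  ([fset e j | j in iota 0 N] `|` [fset p (e j) | j in iota 0 N])%fset.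
have [i i0i di] := dA i0.
have Gi y : [set` ([fset e j | j in iota 0 N] `|` [fset p (e j) | j in iota 0 N])%fset] y ->
    Gs i y by move=> /ei0; exact: filtrationS.
have Ge j : (j < N)%N -> Gs i (e j).
  by move=> jN; apply: Gi; rewrite /= inE in_imfset//= mem_iota.
have Gpe j : (j < N)%N -> Gs i (p (e j)).
  move=> jN; apply: Gi; rewrite /= inE; apply/orP; right.
  by apply/imfsetP; exists j => //=; rewrite mem_iota.
have Gt j : (j < N)%N -> Gs i (t j).
  move=> jN; apply: filtrationB => //; first exact: Ge.
  rewrite big_seq; apply: big_ind => [||i']; first exact: filtration0.
    by move=> y z; exact: filtrationD.
  by rewrite mem_iota => /andP[_ i'j]; apply: Ge; exact: ltn_trans jN.
have dT (j : 'I_N) : (trace_card Gs setT i <= 4 * k * trace_card Gs (T j) i)%N.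
  apply: (leq_trans di); rewrite trace_card_shift//; last exact: Gt.
  rewrite (mulnC 4%N) -mulnA leq_mul2l; apply/orP; right.
  have := trace_card_subset_sumsD1 Gs_filtration A (Ge j (ltn_ord j)).
  move/leq_trans; apply; rewrite -[4%N]/(2 * 2)%N -mulnA leq_mul2l/=.
  exact: trace_card_subset_sumsD1 (Gpe j (ltn_ord j)).
have := sum_trace_card_le Gs_filtration i N T_disj.
have : (N * trace_card Gs setT i <= 4 * k * \sum_(j < N) trace_card Gs (T j) i)%N.
  rewrite big_distrr/= -[X in (X * _)%N]card_ord -sum_nat_const.
  by apply: leq_sum => j _; exact: dT.
move=> NT /(leq_mul (leqnn (4 * k))) /(leq_trans NT).
by rewrite leq_mul2r leqNgt N_gt orbF eqn0Ngt trace_card_setT_gt0.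
Qed.

End DoublingObstruction.

(** Translation by [x] maps the finite set [K] injectively into itself, hence onto, so it reaches
    [0]. *)
Lemma finite_submonoid_opp (G : zmodType) (K : set G) : finite_set K -> K 0 ->
  (forall x y, K x -> K y -> K (x + y)) -> forall x, K x -> K (- x).
Proof.
move=> finK K0 KD x Kx; pose F := fset_set K.
have inF y : y \in F <-> K y by rewrite in_fset_set// inE.
have xFF : ([fset (x + y)%R | y in F] `<=` F)%fset.
  by apply/fsubsetP => _ /imfsetP[y /= /inF Ky ->]; apply/inF; exact: KD.
have /imfsetP[y /= /inF Ky x0] : 0 \in [fset (x + y)%R | y in F]%fset.
  rewrite (_ : [fset (x + y)%R | y in F]%fset = F); first exact/inF.
  by apply/eqP; rewrite eqEfcard xFF (card_imfset imfset_key (mem F) (addrI x))/=.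
by rewrite (_ : - x = y)//; apply/esym/eqP; rewrite -addr_eq0 addrC -x0.
Qed.

(** * Elements that are subset sums together with their doubles *)

Section Doubles.
Variables (G : zmodType) (A : set G).
Implicit Types (E : {fset G}).

(** This is V(E); the sets representing [b] and [b *+ 2] may be unrelated. *)
Definition avoiding_doubles E : set G :=
  [set b | subset_sums (A `\` [set` E]) b /\ subset_sums (A `\` [set` E]) (b *+ 2)].

Lemma avoiding_doublesS E E' : (E `<=` E')%fset ->
  avoiding_doubles E' `<=` avoiding_doubles E.
Proof.
move=> /fsubsetP EE' b [bE' b2E'].
have AE : A `\` [set` E'] `<=` A `\` [set` E] by move=> x [Ax xE']; split => // /EE'.
by split; apply: subset_sumsS AE _ _.
Qed.

Lemma avoiding_doubles0 E : avoiding_doubles E 0.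
Proof. by split; rewrite ?mul0rn; exact: subset_sums0. Qed.

(** Sums of two distinct terms are subset sums because their supports are disjoint, doubled terms
    because the choice demands it. *)
Lemma sumset_infinite_doubles : (forall E, infinite_set (avoiding_doubles E)) ->
  exists B, [/\ infinite_set B, B `<=` subset_sums A & sumset B B `<=` subset_sums A].
Proof.
move=> infV; pose sigma (J : {fset G}) : G := \sum_(a <- J) a.
have [s|J JP] := @seq_dependent_choice {fset G} (fun s J =>
    [/\ [set` J] `<=` A, (forall H, H \in s -> [disjoint H & J]%fset),
        sigma J \notin map sigma s & subset_sums A (sigma J *+ 2)]).
  have [U sU] : exists U : {fset G}, forall H, H \in s -> (H `<=` U)%fset.
    elim: s => [|H s [U sU]]; first by exists fset0.
    exists (H `|` U)%fset => H'; rewrite inE => /predU1P[->|/sU H'U].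
      exact: fsubsetUl.
    exact: fsubset_trans H'U (fsubsetUr _ _).
  (* [U] contains all earlier supports, and the infinite set V(U) is not exhausted by the finitely
     many earlier sums. *)
  have [b [[[J JA <-] b2] bs]] : exists b, avoiding_doubles U b /\ b \notin map sigma s.
    apply: contrapT => /forallNP noV; apply: (infV U).
    apply: (@sub_finite_set _ _ [set` map sigma s]); last exact: finite_seq.
    by move=> b Vb /=; apply: contrapT => /negP bs; apply: (noV b).
  exists J; split => //; first by move=> x /JA[].
    move=> H /sU /fsubsetP HU; apply/fdisjointP => x /HU xU.
    by apply/negP => /JA[_]; apply.
  by apply: subset_sumsS b2 => x [].
have J_lt i j : (i < j)%N -> [disjoint J i & J j]%fset /\ sigma (J j) != sigma (J i).
  have [_ disj sum _] := JP j => ij.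
  have Ji : J i \in [seq J i | i <- iota 0 j] by apply: map_f; rewrite mem_iota.
  by split; [exact: disj|apply: contraNneq sum => ->; exact: map_f].
have sumA i j : subset_sums A (sigma (J i) + sigma (J j)).
  wlog ij : i j / (i <= j)%N.
    by move=> IH; have [/IH//|/ltnW/IH] := leqP i j; rewrite addrC.
  have [JiA _ _ Ji2] := JP i; have [JjA _ _ _] := JP j.
  move: ij; rewrite leq_eqVlt => /predU1P[<-//|/J_lt[disj _]].
  exact: subset_sumsD.
exists (range (sigma \o J)); split.
- move=> fin_range; apply: infinite_nat.
  rewrite (_ : setT = (sigma \o J) @^-1` range (sigma \o J)); last first.
    by apply/seteqP; split => n //= _; exists n.
  apply: finite_preimage fin_range => i j _ _ /= eij.
  by have [/J_lt[_]|/J_lt[_]|//] := ltngtP i j; rewrite eij eqxx.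
- by move=> _ [n _ <-]; have [JA _ _ _] := JP n; exact: subset_sumsI.
- by move=> _ [_ [i _ <-]] [_ [j _ <-]] <-; exact: sumA.
Qed.

(** Enlarging [E] can only shrink V(E), so a finite one of least cardinality stays constant. *)
Lemma stable_avoiding_doubles E0 : finite_set (avoiding_doubles E0) ->
  exists2 E, finite_set (avoiding_doubles E) &
    forall E', (E `<=` E')%fset -> avoiding_doubles E' = avoiding_doubles E.
Proof.
move=> finE0; pose card_is E n :=
  finite_set (avoiding_doubles E) /\ #|` fset_set (avoiding_doubles E)| = n.
have exn : exists n, `[< exists E, card_is E n >].
  by exists #|` fset_set (avoiding_doubles E0)|; apply/asboolP; exists E0.
case: (ex_minnP exn) => _ /asboolP[E [finE <-]] E_min; exists E => // E' EE'.
have E'E := avoiding_doublesS EE'.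
have finE' : finite_set (avoiding_doubles E') by exact: sub_finite_set E'E finE.
apply: fset_set_inj => //; apply/eqP; rewrite eqEfcard.
apply/andP; split; first by rewrite -fset_set_sub.
by apply: E_min; apply/asboolP; exists E'.
Qed.

(** By stability [y] and its double have representations that also avoid the sets representing [x]
    and its double, so these can be joined. *)
Lemma avoiding_doublesD E :
    (forall E', (E `<=` E')%fset -> avoiding_doubles E' = avoiding_doubles E) ->
  forall x y, avoiding_doubles E x -> avoiding_doubles E y -> avoiding_doubles E (x + y).
Proof.
move=> stableE x y [[X XA <-] [X2 X2A xX2]] yE.
pose E' := (E `|` (X `|` X2))%fset.
have [yE' y2E'] : avoiding_doubles E' y by rewrite stableE// fsubsetUl.
have sub Z : (Z `<=` E')%fset ->
    A `\` [set` E'] `<=` A `\` [set` E] `\` [set` Z].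
  move=> /fsubsetP ZE' z [Az zE']; split; last by move=> /ZE'.
  by split => // zE; apply: zE'; rewrite /= inE zE.
split; first apply: subset_sums_addD => //.
  by apply: subset_sumsS yE'; apply: sub; apply/fsubsetP => z; rewrite !inE => ->; rewrite orbT.
rewrite mulrnDl -xX2; apply: subset_sums_addD => //.
by apply: subset_sumsS y2E'; apply: sub; apply/fsubsetP => z; rewrite !inE => ->; rewrite !orbT.
Qed.

End Doubles.

(** * Reduction of the theorem to the doubling obstruction *)

Theorem theorem7p1 (R : realType) (G : zmodType)
    (G_countably_infinite : ([set: G] #= [set: nat])%card)
    (G_locally_finite : locally_finite G)
    (Gs : nat -> set G) (Gs_filtration : filtration Gs)
    (A : set G)
    (A_density : (0 < upper_density R Gs (subset_sums A))%E) :
  exists B : set G,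
    [/\ infinite_set B,
        B `<=` subset_sums A
      & sumset B B `<=` subset_sums A].
Proof.
have G_infinite : infinite_set [set: G].
  by move=> finG; apply: infinite_nat; rewrite -(eq_finite_set G_countably_infinite).
apply: sumset_infinite_doubles => E0 /stable_avoiding_doubles[E finE stableE].
set K := avoiding_doubles A E in finE stableE.
have KD := avoiding_doublesD stableE.
have KN := finite_submonoid_opp finE (avoiding_doubles0 A E) KD.
(* Removing [E] forces doubling sums into [K]; removing [K] makes what is left of [A] disjoint from
   it. *)
pose E' := (E `|` fset_set K)%fset.
have [k0 dA] := frequently_dense_upper_density A_density.
have [k] := frequently_dense_subset_sumsD Gs_filtration E' dA.
apply: (@doubling_obstruction_sparse _ _ K) => //.
- exact: avoiding_doubles0.
- by move=> x y Kx Ky; apply: KD => //; exact: KN.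
(* Stability rewrites each element of [K] as a sum that avoids any further finite set [F]. *)
- move=> F x; rewrite -(stableE (E' `|` F)%fset); last first.
    by rewrite -fsetUA fsubsetUl.
  case=> + _; apply: subset_sumsS => y [Ay /negP].
  by rewrite in_fsetU negb_or => /andP[/negP yE' /negP yF]; split.
- by move=> b bA b2A; rewrite -(stableE E') ?fsubsetUl.
- rewrite -subset0 => x [[_ xE'] Kx]; apply: xE'.
  by rewrite /= inE in_fset_set// mem_set// orbT.
Qed.
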